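(* Let $u$ be a multilinear commutator word and $v$ a non-commutator word, where $u$ and $v$ involve disjoint sets of variables. Then the word $[u,v]$ is concise.
   Context: For a group-word $w=w(x_1,\dots,x_k)$ (an element of the free group on $x_1,\dots,x_k$) and a group $G$, $G_w=\{w(g_1,\dots,g_k): g_i\in G\}$ is the set of $w$-values in $G$, and $w(G)=\langle G_w\rangle$ is the verbal subgroup. A word $w$ is concise if $w(G)$ is finite for every group $G$ such that $G_w$ is finite. A non-commutator word is a word such that the sum of the exponents of some variable involved in it is non-zero. Multilinear commutator words (outer commutators) are the words obtained by nesting commutators, but using always different variables: recursively, a single variable is a multilinear commutator word, and $[a,b]$ is a multilinear commutator word whenever $a$ and $b$ are multilinear commutator words involving disjoint sets of variables. $[x,y]=x^{-1}y^{-1}xy$. *)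

(* Defs.v *)
From HB Require Import structures.
From mathcomp Require Import all_boot ssralg ssrint.
From mathcomp Require Import boolp classical_sets cardinality.

Set Implicit Arguments.
Unset Strict Implicit.
Unset Printing Implicit Defensive.

Local Open Scope classical_set_scope.
Local Open Scope group_scope.

(* The free group on countably many generators x_0, x_1, ..., realized as the
   set of reduced words.  The letter (i, true) stands for x_i and (i, false)
   for x_i^-1. *)
Definition letter : Type := (nat * bool)%type.

Definition letterV (a : letter) : letter := (a.1, ~~ a.2).

Definition reduced (s : seq letter) : bool :=
  sorted (fun a b => b != letterV a) s.

Definition freeGroup : Type := {s : seq letter | reduced s}.
HB.instance Definition _ := Choice.on freeGroup.

(* [push a s] is the reduced form of a :: s when s is reduced. *)
Definition push (a : letter) (s : seq letter) : seq letter :=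
  if s is b :: s' then if b == letterV a then s' else a :: s else [:: a].

Lemma letterVK : involutive letterV.
Proof. by case=> i b; rewrite /letterV /= negbK. Qed.

Lemma reduced_push a s : reduced s -> reduced (push a s).
Proof.
case: s => [|b s] //= rs; case: ifPn => [_|nb]; last by rewrite /= nb.
exact: path_sorted rs.
Qed.

Lemma reduced_foldr s t : reduced t -> reduced (foldr push t s).
Proof. by move=> rt; elim: s => //= a s; apply: reduced_push. Qed.

Lemma pushVK a s : reduced s -> push (letterV a) (push a s) = s.
Proof.
case: s => [|b s] /=; first by rewrite letterVK eqxx.
case: ifPn => [/eqP-> | nb _]; last by rewrite /= letterVK eqxx.
by case: s => //= c s /andP[/negPf-> _].
Qed.

Lemma pushKV a s : reduced s -> push a (push (letterV a) s) = s.
Proof. by move=> rs; rewrite -{1}(letterVK a) pushVK. Qed.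

Lemma foldr_push a s t : reduced t ->
  foldr push t (push a s) = push a (foldr push t s).
Proof.
case: s => [|b s] //= rt; case: ifPn => //= /eqP->.
by rewrite pushKV //; apply: reduced_foldr.
Qed.

Lemma foldr_pushA s t u : reduced u ->
  foldr push u (foldr push t s) = foldr push (foldr push u t) s.
Proof. by move=> ru; elim: s => //= a s IHs; rewrite foldr_push // IHs. Qed.

Lemma foldr_push_nil s : reduced s -> foldr push [::] s = s.
Proof.
elim: s => //= a s IHs rs; rewrite IHs; last exact: path_sorted rs.
by case: s rs {IHs} => //= b s /andP[/negPf->].
Qed.

Lemma reduced_inv s : reduced s -> reduced (rev (map letterV s)).
Proof.
rewrite /reduced rev_sorted sorted_map; apply: sub_sorted => a b /=.
by rewrite letterVK eq_sym.
Qed.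

Lemma foldr_push_inv s : reduced s ->
  foldr push s (rev (map letterV s)) = [::].
Proof.
elim: s => //= a s IHs ras; rewrite rev_cons foldr_rcons.
have rs : reduced s by exact: path_sorted ras.
have -> : push (letterV a) (a :: s) = s by rewrite /= letterVK eqxx.
exact: IHs.
Qed.

Definition fg_one : freeGroup := exist _ [::] isT.

Definition fg_mul (s t : freeGroup) : freeGroup :=
  exist _ (foldr push (val t) (val s)) (reduced_foldr (val s) (valP t)).

Definition fg_inv (s : freeGroup) : freeGroup :=
  exist _ (rev (map letterV (val s))) (reduced_inv (valP s)).

Lemma fg_mulA : associative fg_mul.
Proof. by move=> s t u; apply/val_inj; rewrite /= foldr_pushA //; apply: valP. Qed.

Lemma fg_mul1 : left_id fg_one fg_mul.
Proof. by move=> s; apply/val_inj. Qed.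

Lemma fg_mulr1 : right_id fg_one fg_mul.
Proof. by move=> s; apply/val_inj; rewrite /= foldr_push_nil //; apply: valP. Qed.

Lemma fg_mulV : left_inverse fg_one fg_inv fg_mul.
Proof. by move=> s; apply/val_inj; rewrite /= foldr_push_inv //; apply: valP. Qed.

Lemma fg_invK : involutive fg_inv.
Proof.
move=> s; apply/val_inj; rewrite /= map_rev revK -map_comp.
by rewrite (eq_map letterVK) map_id.
Qed.

Lemma fg_mulrV : right_inverse fg_one fg_inv fg_mul.
Proof. by move=> s; rewrite -{1}[s]fg_invK fg_mulV. Qed.

HB.instance Definition _ := isGroup.Build freeGroup
  fg_mulA fg_mul1 fg_mulr1 fg_mulV fg_mulrV.

Definition fg_gen (i : nat) : freeGroup := exist _ [:: (i, true)] isT.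

(* The variables involved in w, i.e. those occurring in its reduced form. *)
Definition vars (w : freeGroup) : seq nat := [seq a.1 | a <- val w].

Definition disjoint_vars (u v : freeGroup) : Prop :=
  forall i, i \in vars u -> i \notin vars v.

Definition exp_sum (i : nat) (w : freeGroup) : int :=
  (\sum_(a <- val w | a.1 == i) (if a.2 then 1 else - 1))%R.

Definition letter_eval (G : groupType) (g : nat -> G) (a : letter) : G :=
  if a.2 then g a.1 else (g a.1)^-1.

Definition word_eval (G : groupType) (g : nat -> G) (w : freeGroup) : G :=
  \prod_(a <- val w) letter_eval g a.

Lemma word_eval_gen (G : groupType) (g : nat -> G) i :
  word_eval g (fg_gen i) = g i.
Proof. by rewrite /word_eval big_seq1. Qed.

Lemma word_evalM (G : groupType) (g : nat -> G) (u v : freeGroup) :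
  word_eval g (u * v) = word_eval g u * word_eval g v.
Proof.
have evV a : letter_eval g (letterV a) = (letter_eval g a)^-1.
  by case: a => i [] //=; rewrite /letter_eval /= invgK.
rewrite /word_eval /=; elim: (val u) => [|a s IHs] /=.
  by rewrite big_nil mul1g.
rewrite big_cons -mulgA -IHs; case: (foldr push _ s) => [|b t] /=.
  by rewrite big_seq1 big_nil mulg1.
case: ifPn => [/eqP-> | _]; last by rewrite big_cons.
by rewrite big_cons evV mulVKg.
Qed.

(* The set G_w of w-values. *)
Definition word_values (w : freeGroup) (G : groupType) : set G :=
  range (fun g : nat -> G => word_eval g w).
Arguments word_values : clear implicits.

Definition is_subgroup (G : groupType) (H : set G) : Prop :=
  [/\ H 1, (forall x y, H x -> H y -> H (x * y)) & (forall x, H x -> H x^-1)].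

(* w(G), the subgroup generated by the w-values. *)
Definition verbal_subgroup (w : freeGroup) (G : groupType) : set G :=
  smallest (@is_subgroup G) (word_values w G).
Arguments verbal_subgroup : clear implicits.

Definition concise (w : freeGroup) : Prop :=
  forall G : groupType,
    finite_set (word_values w G) -> finite_set (verbal_subgroup w G).

(* [~ a, b] is a^-1 * b^-1 * a * b. *)
Inductive multilinear_commutator : freeGroup -> Prop :=
| MLC_gen i : multilinear_commutator (fg_gen i)
| MLC_comm a b :
    multilinear_commutator a -> multilinear_commutator b ->
    disjoint_vars a b -> multilinear_commutator [~ a, b].

Definition non_commutator (w : freeGroup) : Prop :=
  exists2 i, i \in vars w & exp_sum i w != 0%R.

(* Main.v *)
(* Write S for the set of values of [u, v].  Call a subset X of a group rigid when
   every homomorphism from <X> to a torsion-free abelian group that is finite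
   on X vanishes.  For X, Y invariant under conjugation and f such a
   homomorphism on <S>, S = {[x, y]}, the map f([[x, c], y]) is additive in c
   in <S> and takes finitely many values, since [x ^ c, y] is the product of a
   conjugate of [x, y] and [[x, c], y]; so it vanishes, which means that
   f(c ^ x) - f(c) is invariant under <Y>.  If homomorphisms invariant under Y
   vanish, then f is invariant under X, x |-> f([x, y]) is additive, and f
   vanishes as soon as X is rigid.  Homomorphisms invariant under Y do vanish
   when Y is rigid, because y |-> f([x, y]) is additive; by induction the set
   of values of a multilinear commutator word is rigid.  They also vanish when
   [x, y ^ n] = 1 for some n > 0 depending on x and y, because then
   n f([x, y]) = 0; this holds for the values y of a non-commutator word when S
   is finite, by the pigeonhole principle applied to the [x, y ^ (n k)].
   Thus S is rigid, and a finite rigid set invariant under conjugation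
   generates a finite group: the transfer into the center, which has finite
   index, shows that its elements have finite order, and Dietzmann's lemma
   applies. *)
From HB Require Import structures.
Require Import Defs.
From mathcomp Require Import all_boot ssralg ssrint generic_quotient ring_quotient.
From mathcomp Require Import boolp classical_sets cardinality.

Set Implicit Arguments.
Unset Strict Implicit.
Unset Printing Implicit Defensive.

Import GRing.Theory.

Local Open Scope classical_set_scope.
Local Open Scope group_scope.

(** * Pigeonhole, generated subgroups and commutator identities *)

Lemma finite_range_collision (T : Type) (F : nat -> T) :
  finite_set (range F) -> exists i j, i < j /\ F i = F j.
Proof.
move=> finF; apply: contrapT => noij; have injF : {in setT &, injective F}.
  move=> i j _ _ eqF; apply: contrapT => /eqP; rewrite neq_ltn => /orP[ltij | ltji].
    by apply: noij; exists i, j.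
  by apply: noij; exists j, i.
apply: infinite_nat; apply: (sub_finite_set _ (finite_preimage _ finF)); last first.
  by move=> i j _ _; apply: injF; rewrite in_setT.
by move=> i _; exists i.
Qed.

Definition generated (G : groupType) (X : set G) : set G :=
  smallest (@is_subgroup G) X.

Definition conj_closed (G : groupType) (X : set G) : Prop :=
  forall x g, X x -> X (x ^ g).

Definition comm_values (G : groupType) (X Y : set G) : set G :=
  [set [~ x, y] | x in X & y in Y].

Section Subgroups.
Variable G : groupType.
Implicit Types (X Y H : set G).

Lemma generated_subgroup X : is_subgroup (generated X).
Proof.
split=> [H [[H1 _ _] _] //|x y Xx Xy H HX|x Xx H HX].
  by have [[_ HM _] _] := HX; apply: HM; [apply: Xx | apply: Xy].
by have [[_ _ HV] _] := HX; apply: HV; apply: Xx.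
Qed.

Lemma sub_generated X : X `<=` generated X.
Proof. exact: sub_gen_smallest. Qed.

Lemma generated_sub X H : is_subgroup H -> X `<=` H -> generated X `<=` H.
Proof. exact: smallest_sub. Qed.

Lemma subgroupX H x n : is_subgroup H -> H x -> H (x ^+ n).
Proof.
case=> H1 HM _ Hx; elim: n => [|n IHn]; first by rewrite expg0.
by rewrite expgS; apply: HM.
Qed.

Lemma conj_closed_generated X : conj_closed X -> conj_closed (generated X).
Proof.
move=> cX x g Xx; have [X1 XM XV] := generated_subgroup X.
apply: (generated_sub (H := [set z | generated X (z ^ g)])) Xx.
  split=> [|y z Xy Xz|y Xy] /=; first by rewrite conj1g.
    by rewrite conjMg; apply: XM.
  by rewrite conjVg; apply: XV.
by move=> y Xy; apply: sub_generated; apply: cX.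
Qed.

Lemma conj_closed_comm_values X Y :
  conj_closed X -> conj_closed Y -> conj_closed (comm_values X Y).
Proof.
move=> cX cY _ g [x Xx [y Yy <-]]; rewrite conjRg.
by exists (x ^ g); [apply: cX | exists (y ^ g); first exact: cY].
Qed.

Lemma subgroup_comm H x g :
  is_subgroup H -> conj_closed H -> H x -> H [~ x, g].
Proof. by case=> _ HM HV cH Hx; apply: HM; [apply: HV | apply: cH]. Qed.

Lemma commMgR (x y z : G) : [~ x * y, z] = [~ x, z] ^ y * [~ y, z].
Proof. by rewrite /commg /conjg !invgM -!mulgA !mulVKg. Qed.

Lemma commgMR (x y z : G) : [~ x, y * z] = [~ x, z] * [~ x, y] ^ z.
Proof. by rewrite /commg /conjg !invgM -!mulgA !(mulKg, mulVKg). Qed.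

Lemma comm_generatedl X Y x y : conj_closed X -> conj_closed Y ->
  generated X x -> Y y -> generated (comm_values X Y) [~ x, y].
Proof.
move=> cX cY Xx Yy; have [S1 SM SV] := generated_subgroup (comm_values X Y).
have cS := conj_closed_generated (conj_closed_comm_values cX cY).
apply: (generated_sub
  (H := [set z | generated (comm_values X Y) [~ z, y]])) Xx.
  split=> [|a b Sa Sb|a Sa] /=; first by rewrite comm1g.
    by rewrite commMgR; apply: SM => //; apply: cS.
  have -> : [~ a^-1, y] = ([~ a, y] ^ a^-1)^-1.
    by rewrite /commg /conjg !invgM !invgK -!mulgA mulgV mulg1.
  by apply: SV; apply: cS.
by move=> a Xa; apply: sub_generated; exists a => //; exists y.
Qed.

Lemma comm_generatedr X Y x y : conj_closed X -> conj_closed Y ->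
  X x -> generated Y y -> generated (comm_values X Y) [~ x, y].
Proof.
move=> cX cY Xx Yy; have [S1 SM SV] := generated_subgroup (comm_values X Y).
have cS := conj_closed_generated (conj_closed_comm_values cX cY).
apply: (generated_sub
  (H := [set z | generated (comm_values X Y) [~ x, z]])) Yy.
  split=> [|a b Sa Sb|a Sa] /=; first by rewrite commg1.
    by rewrite commgMR; apply: SM => //; apply: cS.
  have -> : [~ x, a^-1] = ([~ x, a] ^ a^-1)^-1.
    by rewrite /commg /conjg !invgM !invgK -!mulgA !(mulKg, mulVKg) ?mulgV ?mulg1.
  by apply: SV; apply: cS.
by move=> a Ya; apply: sub_generated; exists x => //; exists a.
Qed.

End Subgroups.

(** * Additive maps into torsion-free abelian groups *)

Definition torsion_free (T : zmodType) : Prop :=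
  forall (t : T) n, (t *+ n.+1 = 0 -> t = 0)%R.

(** A homomorphism on a subgroup [H] is encoded as a total map constrained only on [H]. *)
Definition additive_on (G : groupType) (T : zmodType) (H : set G)
    (f : G -> T) : Prop :=
  forall x y, H x -> H y -> f (x * y) = (f x + f y)%R.

Definition rigid (G : groupType) (X : set G) : Prop :=
  forall (T : zmodType) (f : G -> T), torsion_free T ->
    additive_on (generated X) f -> finite_set (f @` X) ->
    forall x, X x -> f x = 0%R.

Section Additive.
Variables (G : groupType) (T : zmodType) (H : set G) (f : G -> T).
Hypotheses (sH : is_subgroup H) (fD : additive_on H f).
Local Open Scope ring_scope.

Lemma additive_on1 : f 1%g = 0.
Proof.
have [H1 _ _] := sH; apply: (addrI (f 1%g)).
by rewrite -fD // mulg1 addr0.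
Qed.

Lemma additive_onV x : H x -> f (x^-1)%g = - f x.
Proof.
move=> Hx; have [_ _ HV] := sH; apply: (addrI (f x)).
by rewrite -fD ?mulgV ?additive_on1 ?subrr //; apply: HV.
Qed.

Lemma additive_onX x n : H x -> f (x ^+ n)%g = f x *+ n.
Proof.
move=> Hx; elim: n => [|n IHn]; first by rewrite expg0 additive_on1.
by rewrite expgS fD ?IHn ?mulrS //; apply: subgroupX.
Qed.

Lemma additive_onJ x y : H x -> H y -> f (x ^ y)%g = f x.
Proof.
move=> Hx Hy; have [_ HM HV] := sH.
by rewrite /conjg !fD ?additive_onV; auto; rewrite addrC addrK.
Qed.

Lemma additive_on_generated X : generated X = H ->
  (forall x, X x -> f x = 0) -> forall x, H x -> f x = 0.
Proof.
move=> eH fX x Hx; have {Hx}: generated X x by rewrite eH.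
have [H1 HM HV] := sH.
move=> Xx; suff [] : H x /\ f x = 0 by [].
apply: (generated_sub (H := [set z | H z /\ f z = 0])) Xx.
  split=> [|y z [Hy fy] [Hz fz]|y [Hy fy]] /=.
  - by rewrite additive_on1.
  - by rewrite fD // fy fz addr0; split=> //; apply: HM.
  - by rewrite additive_onV // fy oppr0; split=> //; apply: HV.
by move=> y Xy; split; [rewrite -eH; apply: sub_generated | apply: fX].
Qed.

(** The multiples of [f x] are the values of [f] at the powers of [x], so two of them coincide and
    some positive multiple of [f x] is zero. *)
Lemma finite_additive_eq0 : torsion_free T -> finite_set (f @` H) ->
  forall x, H x -> f x = 0.
Proof.
move=> tfT finf x Hx; have finx : finite_set (range (fun n => f x *+ n)).
  apply: sub_finite_set finf => _ [n _ <-]; exists (x ^+ n)%g.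
    exact: subgroupX.
  exact: additive_onX.
have [i [j [ltij eqij]]] := finite_range_collision finx.
apply: (tfT _ (j - i).-1); rewrite prednK ?subn_gt0 //.
by rewrite mulrnBr ?(ltnW ltij) // eqij subrr.
Qed.

End Additive.

(** The [z] whose conjugation leaves [f] unchanged on all of [H] form a subgroup, because conjugates
    of elements of [H] stay in [H]. *)
Lemma invariant_generated (G : groupType) (T : Type) (X H : set G) (f : G -> T) :
  conj_closed H -> (forall x c, X x -> H c -> f (c ^ x) = f c) ->
  forall x c, generated X x -> H c -> f (c ^ x) = f c.
Proof.
move=> cH fX x c Xx; move: c.
apply: (generated_sub
  (H := [set z | forall c, H c -> f (c ^ z) = f c])) Xx.
  split=> [c Hc|y z fy fz c Hc|y fy c Hc] /=; first by rewrite conjg1.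
    by rewrite conjgM fz ?fy //; apply: cH.
  by rewrite -[in RHS](conjgKV y c) fy //; apply: cH.
by move=> y Xy c; apply: fX.
Qed.

Lemma finite_image_diff (A : Type) (T : zmodType) (S : set A) (f g : A -> T) :
  finite_set (f @` S) -> finite_set (g @` S) ->
  finite_set ((fun a => f a - g a)%R @` S).
Proof.
move=> finf fing; apply: sub_finite_set (finite_image2 (fun a b => a - b)%R finf fing).
by move=> _ [a Sa <-]; exists (f a); [exists a | exists (g a) => //; exists a].
Qed.

(** * Rigidity of sets of commutators *)

Section Commutators.
Variables (G : groupType) (X Y : set G).
Hypotheses (cX : conj_closed X) (cY : conj_closed Y).
Let S := comm_values X Y.
Let U := generated S.

Let sU : is_subgroup U. Proof. exact: generated_subgroup. Qed.
Let cU : conj_closed U.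
Proof. by apply: conj_closed_generated; apply: conj_closed_comm_values. Qed.
Let SU : S `<=` U. Proof. exact: sub_generated. Qed.

(** For [x] in [U] and [f] additive on [U] this is [f [~ x, g]]. *)
Definition shift (T : zmodType) (f : G -> T) g x := (f (x ^ g)%g - f x)%R.

Section AdditiveMap.
Variables (T : zmodType) (f : G -> T).
Hypothesis (fD : additive_on U f).
Local Open Scope ring_scope.

Lemma additive_on_shift g : additive_on U (shift f g).
Proof.
move=> x y Ux Uy; have [Uxg Uyg] := (cU g Ux, cU g Uy).
by rewrite /shift conjMg (fD Ux Uy) (fD Uxg Uyg) opprD addrACA.
Qed.

Lemma finite_shift g : finite_set (f @` S) -> finite_set (shift f g @` S).
Proof.
move=> finf; apply: finite_image_diff => //; apply: sub_finite_set finf => _ [x Sx <-].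
by exists (x ^ g)%g => //; apply: conj_closed_comm_values.
Qed.

Lemma additive_onR x g : U x -> f [~ x, g]%g = shift f g x.
Proof.
move=> Ux; have [_ _ UV] := sU; have [UVx Uxg] := (UV _ Ux, cU g Ux).
by rewrite (fD UVx Uxg) (additive_onV sU fD) // addrC.
Qed.

End AdditiveMap.

Section Rigidity.
Variables (T : zmodType) (f : G -> T).
Hypotheses (tfT : torsion_free T) (fD : additive_on U f).
Hypothesis (finf : finite_set (f @` S)).
Local Open Scope ring_scope.

(* The commutator [[p, c], q] is, modulo the kernel of [f], the quotient of the
   values [p ^ c, q] and [p, q], yet [f] of it is additive in [c]. *)
Lemma shift_invariant p q c : X p -> Y q -> U c ->
  shift f q (c ^ p)%g = shift f q c.
Proof.
move=> Xp Yq Uc; have [_ _ UV] := sU.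
have Upq : U [~ p, q]%g by apply: SU; exists p => //; exists q.
(* For [d] in [U] this is [- f [~ [~ p, d], q]]; as an iterated shift it is visibly additive in
   [d]. *)
pose phi d := shift (shift f q) p d.
have phiE d : U d -> phi d = f [~ p, q]%g - f [~ p ^ d, q]%g.
  move=> Ud; have Ur : U [~ d, p]%g := subgroup_comm _ sU cU Ud.
  have Us : U [~ p, d]%g by rewrite -invgR; apply: (UV _ Ur).
  have Usq : U [~ [~ p, d], q]%g := subgroup_comm _ sU cU Us.
  have hD := additive_on_shift fD q.
  have -> : (p ^ d = p * [~ p, d])%g by rewrite /commg mulVKg.
  rewrite commMgR (fD (cU _ Upq) Usq) (additive_onJ sU fD) //
     opprD addNKr (additive_onR fD) // -[[~ p, d]%g]invgR.
  by rewrite (additive_onV sU hD) // opprK (additive_onR hD).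
apply/eqP; rewrite -subr_eq0; apply/eqP.
apply: (finite_additive_eq0 (f := phi) sU) => //.
  by apply: additive_on_shift; apply: additive_on_shift.
apply: sub_finite_set (finite_image (fun t => f [~ p, q]%g - t) finf).
move=> _ [d Ud <-]; rewrite phiE //; exists (f [~ p ^ d, q]%g) => //.
by exists [~ p ^ d, q]%g => //; exists (p ^ d)%g; [apply: cX | exists q].
Qed.

(** The roles of [p] and [q] are exchanged: since [p q = q p [p, q]], the elements [(c ^ p) ^ q] and
    [(c ^ q) ^ p] are conjugate by an element of [U], so [f] agrees on them. *)
Lemma shift_generated_invariant p q c : generated X p -> Y q -> U c ->
  shift f p (c ^ q)%g = shift f p c.
Proof.
move=> Xp Yq Uc; have := invariant_generated (f := shift f q) cU _ Xp Uc.
have -> : shift f p (c ^ q)%g = f ((c ^ p) ^ q)%g - f (c ^ q)%g.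
  have -> : ((c ^ p) ^ q = ((c ^ q) ^ p) ^ [~ p, q])%g by rewrite -!conjgM mulgA -commgC.
  have Upq : U [~ p, q]%g := comm_generatedl cX cY Xp Yq.
  by rewrite (additive_onJ sU fD (cU p (cU q Uc)) Upq).
move=> /(_ (fun x d Xx Ud => shift_invariant Xx Yq Ud)) eq_f.
apply/eqP; rewrite subr_eq; move/eqP: eq_f; rewrite subr_eq => /eqP->.
by rewrite /shift addrC -[X in _ == X]addrA [- _ + _]addrC.
Qed.

Hypothesis rX : rigid X.
(** Left abstract because it is obtained in two ways: from rigidity of [Y], or from relations
    [[~ x, y ^+ n.+1] = 1]. *)
Hypothesis vanish : forall h : G -> T, additive_on U h -> finite_set (h @` S) ->
  (forall y c, Y y -> U c -> h (c ^ y)%g = h c) -> forall x, S x -> h x = 0.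

(** Each [shift f p] is invariant under [Y], hence zero on [U]. So [f] is invariant under
    [generated X], which makes [f [~ p, q]] additive in [p], and rigidity of [X] applies. *)
Lemma comm_vanish x : S x -> f x = 0.
Proof.
have f_inv p c : generated X p -> U c -> f (c ^ p)%g = f c.
  move=> Xp Uc; apply/eqP; rewrite -subr_eq0; apply/eqP.
  have shiftD := additive_on_shift fD p.
  apply: (additive_on_generated sU shiftD (X := S)) => //.
  apply: vanish => //; first exact: finite_shift.
  by move=> q d Yq Ud; apply: shift_generated_invariant.
case=> p Xp [q Yq <-].
apply: (rX (f := fun p => f [~ p, q]%g)) => //.
  move=> a b Xa Xb.
  have Ua : U [~ a, q]%g := comm_generatedl cX cY Xa Yq.
  have Ub : U [~ b, q]%g := comm_generatedl cX cY Xb Yq.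
  by rewrite commMgR (fD (cU b Ua) Ub) f_inv.
apply: sub_finite_set finf => _ [a Xa <-]; exists [~ a, q]%g => //.
by exists a => //; exists q.
Qed.

End Rigidity.

Lemma rigid_comm_values : rigid X -> rigid Y -> rigid S.
Proof.
move=> rX rY T f tfT fD finf; apply: comm_vanish => // h hD finh h_inv x.
case=> p Xp [q Yq <-].
apply: (rY _ (fun q => h [~ p, q])) => //.
  move=> a b Ya Yb.
  have Ua : U [~ p, a] := comm_generatedr cX cY Xp Ya.
  have Ub : U [~ p, b] := comm_generatedr cX cY Xp Yb.
  rewrite commgMR (hD _ _ Ub (cU b Ua)) addrC.
  by rewrite (invariant_generated cU h_inv Yb Ua).
apply: sub_finite_set finh => _ [a Ya <-]; exists [~ p, a] => //.
by exists p => //; exists a.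
Qed.

Lemma rigid_comm_values_power : rigid X ->
  (forall x y, X x -> Y y -> exists n, [~ x, y ^+ n.+1] = 1) -> rigid S.
Proof.
move=> rX commXY T f tfT fD finf; apply: comm_vanish => // h hD finh h_inv x.
case=> p Xp [q Yq <-]; have [n pqn] := commXY _ _ Xp Yq; apply: (tfT _ n).
(* Invariance of [h] under [q] removes the conjugation in the expansion of [[~ p, q ^+ m * q]]. *)
have hX m : h [~ p, q ^+ m] = (h [~ p, q] *+ m)%R.
  elim: m => [|m IHm]; first by rewrite expg0 commg1 (additive_on1 sU hD).
  have Uq : U [~ p, q] by apply: SU; exists p => //; exists q.
  have Um : U [~ p, q ^+ m].
    apply: comm_generatedr => //; apply: subgroupX (generated_subgroup _) _.
    exact: sub_generated.
  by rewrite expgSr commgMR (hD _ _ Uq (cU q Um)) h_inv // IHm mulrS.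
by rewrite -hX pqn (additive_on1 sU hD).
Qed.
End Commutators.

(** * Values of words *)

Section WordValues.
Variable G : groupType.
Implicit Types (g : nat -> G) (w u v : freeGroup).

Lemma word_eval1 g : word_eval g 1 = 1.
Proof. by rewrite /word_eval big_nil. Qed.

Lemma word_evalV g w : word_eval g w^-1 = (word_eval g w)^-1.
Proof.
by apply: (mulIg (word_eval g w)); rewrite -word_evalM !mulVg word_eval1.
Qed.

Lemma word_evalR g u v :
  word_eval g [~ u, v] = [~ word_eval g u, word_eval g v].
Proof. by rewrite /commg /conjg !word_evalM !word_evalV. Qed.

Lemma eq_word_eval g h w :
  (forall i, i \in vars w -> g i = h i) -> word_eval g w = word_eval h w.
Proof.
move=> eq_gh; apply: eq_big_seq => a wa; rewrite /letter_eval eq_gh //.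
exact: map_f.
Qed.

Lemma word_evalJ g w x : word_eval g w ^ x = word_eval (fun i => g i ^ x) w.
Proof.
rewrite /word_eval conjg_prod; apply: eq_bigr => a _.
by rewrite /letter_eval; case: ifP => // _; rewrite conjVg.
Qed.

Lemma conj_closed_word_values w : conj_closed (word_values w G).
Proof. by move=> _ x [g _ <-]; rewrite word_evalJ; exists (fun i => g i ^ x). Qed.

Lemma word_values_comm u v : disjoint_vars u v ->
  word_values [~ u, v] G = comm_values (word_values u G) (word_values v G).
Proof.
move=> uv; apply/seteqP; split=> [_ [g _ <-]|_ [_ [g _ <-] [_ [h _ <-] <-]]].
  rewrite word_evalR; exists (word_eval g u); first by exists g.
  by exists (word_eval g v) => //; exists g.
exists (fun i => if i \in vars u then g i else h i) => //.
rewrite word_evalR; congr [~ _, _]; apply: eq_word_eval => i; first by move->.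
by case: ifPn => // /uv /negPf->.
Qed.

Lemma rigid_subgroup (H : set G) : is_subgroup H -> rigid H.
Proof.
move=> sH T f tfT; rewrite /generated (smallest_id sH) => fD finf.
exact: finite_additive_eq0.
Qed.

Lemma rigid_multilinear u : multilinear_commutator u -> rigid (word_values u G).
Proof.
elim=> [i|a b _ rA _ rB ab]; last first.
  by rewrite word_values_comm //; apply: rigid_comm_values => //;
     apply: conj_closed_word_values.
apply: rigid_subgroup; have -> : word_values (fg_gen i) G = setT.
  by apply/seteqP; split=> // x _; exists (fun=> x) => //; apply: word_eval_gen.
by split.
Qed.

(** With 1 for all variables but [i], the value is [x] to the exponent sum of [i]; the inverse
    letters are moved across the equation to keep exponents natural. *)
Lemma word_eval_single i w (x : G) :
  word_eval (fun j => if j == i then x else 1) w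
    * x ^+ count (pred1 (i, false)) (val w) = x ^+ count (pred1 (i, true)) (val w).
Proof.
rewrite /word_eval; elim: (val w) => [|[j e] s IHs] /=.
  by rewrite big_nil mulg1.
rewrite big_cons /letter_eval /= !xpair_eqE; case: eqP => _ /=; last first.
  by rewrite invg1 if_same mul1g.
case: e => /=; first by rewrite -mulgA IHs -expgS.
have cx : commute x (\prod_(a <- s) letter_eval (fun j => if j == i then x else 1) a).
  apply: commute_prod => a _; rewrite /letter_eval.
  by case: ifP => _; case: ifP => _ //; [apply: commute1 | apply: commuteV |
     rewrite invg1; apply: commute1].
by rewrite add0n add1n expgS -IHs -mulgA [X in _ * X]mulgA -cx -mulgA mulKg.
Qed.

Lemma exp_sumE i w :
  exp_sum i w = (Posz (count (pred1 (i, true)) (val w))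
                 - Posz (count (pred1 (i, false)) (val w)))%R.
Proof.
rewrite /exp_sum; elim: (val w) => [|[j e] s IHs] /=; first by rewrite big_nil.
rewrite big_cons IHs /= !xpair_eqE; case: eqP => _ //=.
case: e; first by rewrite /= add0n PoszD addrA.
by rewrite /= add0n PoszD opprD addrCA.
Qed.

Lemma non_commutator_power v : non_commutator v ->
  exists n, forall x : G, word_values v G (x ^+ n.+1).
Proof.
case=> i _; rewrite exp_sumE subr_eq0 eqz_nat.
set p := count _ _; set q := count _ _ => neq_pq.
have vx x : word_values v G (x ^+ p / x ^+ q).
  by have := word_eval_single i v x; rewrite -/p -/q => <-; rewrite mulgK; eexists.
case: (ltngtP p q) neq_pq => // [ltpq | ltqp] _.
  (* The exponent sum is negative here, so [x^-1] is substituted for [x]. *)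
  exists (q - p).-1 => x; rewrite prednK ?subn_gt0 // expgnFr ?(ltnW ltpq) //.
  by have := vx x^-1; rewrite !expVgn invgK -(commuteV (commuteX2 q p (commute_refl x))).
by exists (p - q).-1 => x; rewrite prednK ?subn_gt0 // expgnFr // ltnW.
Qed.

(** Every [(y ^+ k) ^+ n.+1] is a value of [v], so finiteness forces [[~ x, y ^+ a] = [~ x, y ^+ b]]
    for some [a < b]; then [y ^+ (b - a)] commutes with [x]. *)
Lemma finite_comm_values_power v (X : set G) x y : non_commutator v ->
  finite_set (comm_values X (word_values v G)) -> X x ->
  exists n, [~ x, y ^+ n.+1] = 1.
Proof.
move=> /non_commutator_power[n vX] finS Xx.
have finF : finite_set (range (fun k => [~ x, (y ^+ k) ^+ n.+1])).
  apply: sub_finite_set finS => _ [k _ <-].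
  by exists x => //; exists ((y ^+ k) ^+ n.+1).
have [i [j [ltij]]] := finite_range_collision finF.
rewrite /commg => /mulgI; rewrite -!expgnA => eqF.
exists ((j - i) * n.+1).-1; rewrite prednK ?muln_gt0 ?subn_gt0 ?ltij //.
apply/eqP; rewrite -conjg_fix; apply/eqP/(@conjg_inj G (y ^+ (i * n.+1))).
by rewrite -conjgM -expgnDr -mulnDl subnK ?(ltnW ltij).
Qed.

End WordValues.

(** * Torsion-free quotient of an abelian subgroup *)

Lemma torsion_free_quotient (G : groupType) (A : set G) :
  is_subgroup A -> (forall x y, A x -> A y -> x * y = y * x) ->
  exists (T : zmodType) (f : G -> T), [/\ torsion_free T, additive_on A f &
    forall x, A x -> f x = 0%R -> exists n, x ^+ n.+1 = 1].
Proof.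
move=> [A1 AM AV] AC.
pose S := {x : G | `[< A x >]}.
have SA (x : S) : A (val x) by apply/asboolP/(valP x).
pose mk x (Ax : A x) : S := exist _ x (introT (asboolP _) Ax).
pose S0 := mk 1 A1.
pose SN (x : S) := mk _ (AV _ (SA x)).
pose SD (x y : S) := mk _ (AM _ _ (SA x) (SA y)).
have SDA : associative SD by move=> x y z; apply: val_inj; rewrite /= mulgA.
have SDC : commutative SD by move=> x y; apply: val_inj; apply: AC; apply: SA.
have S0D : left_id S0 SD by move=> x; apply: val_inj; rewrite /= mul1g.
have SND : left_inverse S0 SN SD by move=> x; apply: val_inj; rewrite /= mulVg.
pose V : zmodType := HB.pack S (GRing.isZmodule.Build S SDA SDC S0D SND).
have valX (x : V) n : val (x *+ n)%R = val x ^+ n.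
  by elim: n => [|n IHn]; rewrite ?expg0 // mulrS expgS -IHn.
pose tor (x : V) : bool := `[< exists n, (x *+ n.+1 = 0)%R >].
have torZ : zmod_closed tor.
  split=> [|x y]; first by apply/asboolP; exists 0%N; rewrite mulr1n.
  move=> /asboolP[m xm0] /asboolP[n yn0]; apply/asboolP; exists (m.+1 * n.+1).-1.
  rewrite prednK ?muln_gt0 // mulrnBl mulrnA xm0 mul0rn mulnC mulrnA yn0 mul0rn.
  by rewrite subr0.
pose I : zmodClosed V := HB.pack tor (GRing.isZmodClosed.Build V tor torZ).
pose T : zmodType := Quotient.quot I.
have pi0 (x : V) : (\pi_(Quotient.quot I)%qT x == 0 :> T)%R = (x \in tor).
  rewrite -[RHS]/(x \in I) -[x in RHS]subr0 Quotient.idealrBE.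
  by rewrite raddf0.
(* The projection of [A] modulo its torsion subgroup, with the default value 0 outside [A]. *)
pose f x : T :=
  if pselect (A x) is left Ax then \pi_(Quotient.quot I)%qT (mk x Ax : V) else 0%R.
have fE x (Ax : A x) : f x = \pi_(Quotient.quot I)%qT (mk x Ax : V).
  by rewrite /f; case: pselect => // Ax'; congr (\pi_ _ _)%qT; apply: val_inj.
exists T, f; split=> [t n|x y Ax Ay|x Ax].
- rewrite -[t](@reprK _ (Quotient.quot I)) -raddfMn /= => /eqP.
  rewrite pi0 => /asboolP[m xnm0]; apply/eqP; rewrite pi0; apply/asboolP.
  by exists (n.+1 * m.+1).-1; rewrite prednK ?muln_gt0 // mulrnA.
- rewrite (fE x Ax) (fE y Ay) (fE _ (AM _ _ Ax Ay)) -raddfD; congr (\pi_ _ _)%qT.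
  exact: val_inj.
move/eqP; rewrite (fE x Ax) pi0 => /asboolP[n xn0]; exists n.
by have := congr1 val xn0; rewrite valX.
Qed.

(** * Finite sets closed under conjugation: transfer and Dietzmann's lemma *)

Lemma finite_bounded_seqs (T : eqType) (e : seq T) n :
  finite_set [set l | size l <= n /\ {subset l <= e}].
Proof.
elim: n => [|n IHn].
  apply: sub_finite_set (finite_set1 [::]) => l [] /=.
  by rewrite leqn0 size_eq0 => /eqP->.
have fine : finite_set [set` e] by apply/finite_seqP; exists e.
have fin2 := finite_image2 (@cons T) fine IHn.
apply: (sub_finite_set (B := [::] |` _)); last first.
  by rewrite finite_setU; split; [exact: finite_set1 | exact: fin2].
case=> [|a l] [/= szl sle]; [by left | right].
exists a; first by apply: sle; rewrite mem_head.
exists l => //; split=> // x lx; apply: sle.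
by rewrite in_cons lx orbT.
Qed.

Section FiniteConjugacyClosed.
Variables (G : groupType) (e : seq G).
Hypothesis ce : conj_closed [set` e].
Let W := generated [set` e].

Let sW : is_subgroup W. Proof. exact: generated_subgroup. Qed.

Let act (k : seq G) (x : G) := [seq y ^ x | y <- k].

Let act1 k : act k 1 = k.
Proof. by rewrite /act -[RHS]map_id; apply: eq_map => y; apply: conjg1. Qed.

Let actM k x y : act k (x * y) = act (act k x) y.
Proof. by rewrite /act -map_comp; apply: eq_map => z /=; rewrite conjgM. Qed.

(** The stabilizer of the sequence [e] in [W] is the center of [W], called [Z] below, so finiteness
    of this orbit says that the center has finite index. *)
Let orbit : set (seq G) := act e @` W.

Let orbit_sub k : orbit k -> {subset k <= e}.
Proof. by case=> x _ <- _ /mapP[y ey ->]; apply: ce. Qed.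

Let finite_orbit : finite_set orbit.
Proof.
apply: sub_finite_set (finite_bounded_seqs e (size e)) => k Kk.
by split; [case: Kk => x _ <-; rewrite size_map | apply: orbit_sub].
Qed.

Let Z : set G := [set x | W x /\ forall y, y \in e -> y ^ x = y].

Let sZ : is_subgroup Z.
Proof.
have [W1 WM WV] := sW; split=> [|x y [Wx ex] [Wy ey]|x [Wx ex]].
- by split=> // y _; rewrite conjg1.
- by split=> [|z ez]; [apply: WM | rewrite conjgM ex ?ey].
by split=> [|y ey]; [apply: WV | rewrite -[in LHS](ex y ey) conjgK].
Qed.

Let Z_act x : W x -> act e x = e -> Z x.
Proof.
move=> Wx; rewrite -[in RHS](map_id e) => /eq_in_map eqe.
by split=> // y /eqe.
Qed.

Let Z_central x w : Z x -> W w -> w * x = x * w.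
Proof.
move=> [_ ex]; move: w; apply: generated_sub.
  split=> [|y z yx zx|y yx] /=; first by rewrite mul1g mulg1.
    by rewrite -mulgA zx mulgA yx mulgA.
  by apply: (mulgI y); rewrite mulVKg mulgA yx mulgK.
by move=> y /ex yx /=; rewrite conjgC yx.
Qed.

(** Rigidity makes the transfer vanish on [W], while on a central element it is [f] times the index.
    A central power of [s] is thus killed by [f], hence has finite order. *)
Lemma rigid_finite_order s : rigid [set` e] -> s \in e ->
  exists n, s ^+ n.+1 = 1.
Proof.
move=> rE es; have [W1 WM WV] := sW.
have We y : y \in e -> W y by move=> ey; apply: sub_generated.
have ZC x y : Z x -> Z y -> x * y = y * x by move=> [Wx _] /Z_central->.
have [T [f [tfT fD f0]]] := torsion_free_quotient sZ ZC.
have /finite_seqP[ks0 K_ks0] := finite_orbit.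
pose ks := undup ks0.
have Kks k : (k \in ks) <-> orbit k by rewrite mem_undup K_ks0.
(* [r k] carries [e] to [k]; the value 1 off [ks] is a default. *)
have /choice[r rP] k : exists x, k \in ks -> W x /\ act e x = k.
  have [/Kks [x Wx <-]|nk] := boolP (k \in ks); first by exists x.
  by exists 1.
have Kact k x : k \in ks -> W x -> act k x \in ks.
  move=> /rP[Wr <-] Wx; rewrite -actM; apply/Kks.
  by exists (r k * x) => //; apply: WM.
pose z k x := r k * x * (r (act k x))^-1.
have Zz k x : k \in ks -> W x -> Z (z k x).
  move=> kk Wx; have [Wr rk] := rP k kk; have [Wr' rk'] := rP _ (Kact k x kk Wx).
  apply: Z_act; first by apply: WM (WM _ _ Wr Wx) (WV _ Wr').
  by rewrite /z !actM rk -{1}rk' -actM mulgV act1.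
(* The transfer from [W] to its center [Z], followed by [f]; the elements of
   [orbit] correspond to the cosets of [Z], with representatives [r k]. *)
pose t x := (\sum_(k <- ks) f (z k x))%R.
have tD : additive_on W t.
  move=> x y Wx Wy; rewrite /t.
  (* Since [x] permutes [ks], the sum for [y] can be reindexed to match the cocycle identity
     [z k (x * y) = z k x * z (act k x) y]. *)
  have act_perm : perm_eq [seq act k x | k <- ks] ks.
    apply: uniq_perm; rewrite ?undup_uniq //.
      rewrite map_inj_uniq ?undup_uniq // => k1 k2 /(congr1 (act^~ x^-1)).
      by rewrite -!actM mulgV !act1.
    move=> k; apply/mapP/idP => [[k1 kk1 ->]|kk]; first exact: Kact.
    exists (act k x^-1); first by apply: Kact => //; apply: WV.
    by rewrite -actM mulVg act1.
  rewrite -[X in (_ + X)%R](perm_big _ act_perm) big_map -big_split /=.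
  apply: eq_big_seq => k kk; rewrite -fD; [|exact: Zz|apply: Zz => //; exact: Kact].
  by rewrite /z actM !mulgA mulgVK.
have tE x : x \in e -> t x = 0%R.
  apply: rE tfT tD _ x; apply: finite_image; apply/finite_seqP; by exists e.
have t0 := additive_on_generated sW tD (erefl W) tE.
have finF : finite_set (range (fun i => act e (s ^+ i))).
  apply: sub_finite_set finite_orbit => _ [i _ <-].
  by exists (s ^+ i) => //; apply: subgroupX (We _ es).
have [i [j [ltij eqij]]] := finite_range_collision finF.
have Zs : Z (s ^+ (j - i)).
  apply: Z_act; first by apply: subgroupX (We _ es).
  by rewrite expgnFr ?(ltnW ltij) // actM -eqij -actM mulgV act1.
set c := s ^+ (j - i) in Zs.
(* The central element [c] fixes every [k] in [ks], so [z k c = c]. *)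
have ts : t c = (f c *+ size ks)%R.
  rewrite /t big_seq (eq_bigr (fun=> f c)) => [|k kk].
    by rewrite -big_seq big_const_seq count_predT iter_addr_0.
  have act_k : act k c = k.
    rewrite -[RHS]map_id; apply/eq_in_map => y ky.
    have [_ Zy] := Zs; apply: Zy; apply: orbit_sub ky; exact/Kks.
  have [Wr _] := rP k kk.
  by rewrite /z act_k (Z_central Zs Wr) mulgK.
have ks_gt0 : 0 < size ks.
  have : e \in ks by apply/Kks; exists 1.
  by case: (ks).
have fs0 : f c = 0%R.
  apply: (tfT _ (size ks).-1); rewrite prednK // -ts; apply: t0.
  by case: Zs.
have [n sn] := f0 _ Zs fs0; exists ((j - i) * n.+1).-1.
by rewrite prednK ?muln_gt0 ?subn_gt0 ?ltij // expgnA.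
Qed.

(** Moving [s ^+ c] to the left across a factor [a] turns [a] into [a ^ (s ^+ c)], which is still in
    [e]. *)
Lemma prod_extract s c (l : seq G) : {subset l <= e} -> c <= count_mem s l ->
  exists l', [/\ {subset l' <= e}, size l' + c = size l &
    \prod_(x <- l) x = s ^+ c * \prod_(x <- l') x].
Proof.
elim: l c => [|a l IHl] c le /=.
  by rewrite leqn0 => /eqP->; exists [::]; rewrite big_nil mulg1.
have {}le : a \in e /\ {subset l <= e}.
  by split=> [|x lx]; apply: le; rewrite in_cons ?eqxx ?lx ?orbT.
case: le => ea le; case: c => [|c].
  exists (a :: l); rewrite addn0 mul1g; split=> // x.
  by rewrite in_cons => /predU1P[->|/le].
have [->|_] := eqVneq a s; rewrite ?add1n ?add0n => lec.
  have [l' [le' sz_l' eq_l']] := IHl c le lec.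
  by exists l'; rewrite addnS sz_l' big_cons eq_l' mulgA -expgS.
have [l' [le' sz_l' eq_l']] := IHl c.+1 le lec.
exists (a ^ (s ^+ c.+1) :: l'); split=> [x||]; last 1 first.
- by rewrite !big_cons eq_l' mulgA [a * _]conjgC -mulgA.
- by rewrite in_cons => /predU1P[->|/le' //]; apply: ce.
by rewrite /= addSn sz_l'.
Qed.

(** Filtering out the elements of [e] one by one removes at most [m] entries of [l] each time. *)
Lemma size_le_counts m (l : seq G) :
  {subset l <= e} -> {in e, forall s, count_mem s l <= m} ->
  size l <= size e * m.
Proof.
elim: e l => [|s f IHf] l lf lem; first by case: l lf {lem} => // a l /(_ a (mem_head _ _)).
rewrite -(count_predC (pred1 s) l) mulSn leq_add ?lem ?mem_head //.
rewrite -size_filter; apply: IHf => [x|x fx].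
  by rewrite mem_filter => /andP[/= /negPf nxs /lf]; rewrite in_cons nxs.
apply: leq_trans (lem x _); last by rewrite in_cons fx orbT.
by rewrite count_filter; apply: sub_count => y /andP[].
Qed.

Lemma common_exponent (f : seq G) :
  {in f, forall s, exists n, s ^+ n.+1 = 1} ->
  exists n, {in f, forall s, s ^+ n.+1 = 1}.
Proof.
elim: f => [|a f IHf] finf; first by exists 0.
have [|n fn] := IHf; first by move=> s fs; apply: finf; rewrite in_cons fs orbT.
have [m am] := finf a (mem_head a f); exists (m.+1 * n.+1).-1 => s.
rewrite prednK ?muln_gt0 // in_cons => /predU1P[->|fs].
  by rewrite expgnA am expg1n.
by rewrite mulnC expgnA fn // expg1n.
Qed.

(* Dietzmann's lemma: in a long product of elements of [e] some [s] occurs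
   often enough that its occurrences, moved to the front at the cost of
   conjugating the other factors, cancel out. *)
Lemma finite_generated :
  {in e, forall s, exists n, s ^+ n.+1 = 1} -> finite_set W.
Proof.
move=> /common_exponent[m em].
have shorten (l : seq G) : {subset l <= e} -> exists l',
    [/\ {subset l' <= e}, size l' <= size e * m & \prod_(x <- l) x = \prod_(x <- l') x].
  have [n] := ubnP (size l); elim: n l => // n IHn l lt_l le.
  have [short|long] := leqP (size l) (size e * m); first by exists l.
  have [s es lec] : exists2 s, s \in e & m.+1 <= count_mem s l.
    apply: contrapT => no_s; move: long; rewrite ltnNge size_le_counts // => s es.
    by rewrite leqNgt; apply/negP => ?; apply: no_s; exists s.
  have [l' [le' sz_l' eq_l']] := prod_extract le lec.
  have [|l'' [le'' sz_l'' eq_l'']] := IHn l' _ le'.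
    by move: lt_l; rewrite -sz_l' addnS ltnS; apply: leq_ltn_trans; apply: leq_addr.
  by exists l''; rewrite eq_l' em // mul1g.
pose P := [set l : seq G | size l <= size e * m /\ {subset l <= e}].
have finP : finite_set P := finite_bounded_seqs e _.
apply: sub_finite_set (finite_image (fun l => \prod_(x <- l) x) finP).
have WP : W `<=` [set x | exists2 l, {subset l <= e} & x = \prod_(y <- l) y].
  apply: generated_sub => [|x ex]; last first.
    by exists [:: x]; [move=> y; rewrite inE => /eqP-> | rewrite big_seq1].
  split=> [|_ _ [k ke ->] [l le ->]|_ [l le ->]].
  - by exists [::] => //; rewrite big_nil.
  - exists (k ++ l); last by rewrite big_cat.
    by move=> y; rewrite mem_cat => /orP[/ke | /le].
  elim: l le => [|a l IHl] le; first by exists [::] => //; rewrite big_nil invg1.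
  have [|k ke eq_k] := IHl; first by move=> y ly; apply: le; rewrite in_cons ly orbT.
  have ea : a \in e by apply: le; apply: mem_head.
  (* As [a ^+ m.+1 = 1], the inverse of [a] is the product of [m] copies of [a]. *)
  exists (k ++ nseq m a).
    by move=> y; rewrite mem_cat => /orP[/ke //|]; rewrite mem_nseq => /andP[_ /eqP->].
  rewrite big_cons invgM eq_k big_cat; congr (_ * _).
  have -> : \prod_(y <- nseq m a) y = a ^+ m.
    elim: (m) => [|p IHp]; first by rewrite big_nil.
    by rewrite big_cons IHp -expgS.
  by apply: (mulgI a); rewrite mulgV -expgS em.
move=> x /WP[l le ->]; have [l' [le' sz ->]] := shorten l le.
by exists l'.
Qed.

End FiniteConjugacyClosed.

Theorem theorem1p6 (u v : freeGroup)
    (hu : multilinear_commutator u) (hv : non_commutator v)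
    (huv : disjoint_vars u v) :
  concise [~ u, v]%g.
Proof.
move=> G; rewrite /verbal_subgroup word_values_comm // => finS.
have [cu cv] := (@conj_closed_word_values G u, @conj_closed_word_values G v).
have cS := conj_closed_comm_values cu cv.
have rS : rigid (comm_values (word_values u G) (word_values v G)).
  apply: rigid_comm_values_power => // [|x y ux _]; first exact: rigid_multilinear.
  exact: finite_comm_values_power finS ux.
have /finite_seqP[e eS] := finS; rewrite eS in cS rS *.
by apply: finite_generated => // s; apply: rigid_finite_order.
Qed.
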